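(* For every natural number $n$, there are a theory $\Gamma_{n+1}$ and a sentence $\varphi$ in the language $\mathcal{L}_2$ (over some set $P$ of nouns and some set $R$ of verbs) such that $\Gamma_{n+1}\models\varphi$ and $\Gamma_{n+1}\not\models_n\varphi$. As a consequence, there is no sound and complete syllogistic proof system for $\mathcal{L}_2$.
   Context: Syntax of $\mathcal{L}_2$. Given a set $P$ of nouns and a set $R$ of verbs (these sets may be arbitrarily large), the terms are: every noun $p\in P$ is a term; if $r\in R$ and $x$ is a term then $(r\ \mathsf{all}\ x)$ is a term. The sentences are $(\mathsf{all}\ x\ y)$ and $(\mathsf{some}\ x\ y)$ for terms $x,y$. A theory is a set of sentences. Semantics. A model $\mathcal{M}$ is a set $M$ (possibly empty) with subsets $[\![p]\!]\subseteq M$ for $p\in P$ and relations $[\![r]\!]\subseteq M\times M$ for $r\in R$. Put $[\![r\ \mathsf{all}\ x]\!]=\{m\in M: m\,[\![r]\!]\,n\text{ for all }n\in[\![x]\!]\}$. $\mathcal{M}\models(\mathsf{all}\ x\ y)$ iff $[\![x]\!]\subseteq[\![y]\!]$; $\mathcal{M}\models(\mathsf{some}\ x\ y)$ iff $[\![x]\!]\cap[\![y]\!]\neq\emptyset$. $\Gamma\models\varphi$ means every model satisfying all sentences of $\Gamma$ satisfies $\varphi$. Degree $k$ consequence. $\Gamma\models_k\varphi$ holds if there is a finite tree with root labeled $\varphi$, nodes labeled by sentences, such that each node either is a leaf whose label is in $\Gamma$, or is labeled by a sentence $\psi$ and has children labeled $\psi_1,\dots,\psi_j$ for some $j\le k$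 with $\{\psi_1,\dots,\psi_j\}\models\psi$. Syllogistic proof systems. Term templates are built like terms but using noun variables and verb variables in place of nouns and verbs, and additionally allowing term variables as templates; sentence templates are built from term templates as sentences are built from terms, and additionally a sentence variable is a sentence template. A syllogistic rule consists of finitely many (possibly zero) sentence templates as premises and one sentence template as conclusion. A syllogistic proof system is a finite set of syllogistic rules (the same rules are used for all choices of $P$ and $R$). A substitution instance of a rule is obtained by substituting nouns, verbs, terms, sentences for noun, verb, term, sentence variables respectively. $\Gamma\vdash^*\varphi$ means there is a finite tree with root $\varphi$ in which each node is either a leaf belonging to $\Gamma$, or is the conclusion, with its children the premises, of a substitution instance of a rule. The system is sound if $\Gamma\vdash^*\varphi$ implies $\Gamma\models\varphi$, and complete if $\Gamma\models\varphi$ implies $\Gamma\vdash^*\varphi$, for all theories $\Gamma$ and sentences $\varphi$ (over all sets $P$, $R$). *)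

(* Defs.v *)
(* Stdlib only: the syllogistic language L2, its semantics, and syllogistic
   proof systems. *)
From Stdlib Require Import List.

Set Implicit Arguments.

Inductive term (P R : Type) : Type :=
| Noun : P -> term P R
| VerbAll : R -> term P R -> term P R.

Inductive sentence (P R : Type) : Type :=
| All : term P R -> term P R -> sentence P R
| Some_ : term P R -> term P R -> sentence P R.

Definition theory (P R : Type) : Type := sentence P R -> Prop.

(* The carrier may be empty. *)
Record model (P R : Type) : Type := Model {
  carrier :> Type;
  noun_int : P -> carrier -> Prop;
  verb_int : R -> carrier -> carrier -> Prop
}.

Fixpoint term_int (P R : Type) (M : model P R) (x : term P R) : M -> Prop :=
  match x with
  | Noun _ p => noun_int M p
  | VerbAll r y => fun m => forall n : M, term_int M y n -> verb_int M r m n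
  end.

Definition satisfies (P R : Type) (M : model P R) (phi : sentence P R) : Prop :=
  match phi with
  | All x y => forall m : M, term_int M x m -> term_int M y m
  | Some_ x y => exists m : M, term_int M x m /\ term_int M y m
  end.

Definition entails (P R : Type) (G : theory P R) (phi : sentence P R) : Prop :=
  forall M : model P R, (forall psi, G psi -> satisfies M psi) -> satisfies M phi.

(* Existence of a finite tree with the given root label in which every node is
   either a leaf labelled in G, or is related by [step] to the list of labels
   of its children.  A node without children is allowed when [step nil psi]. *)
Inductive derivable (P R : Type) (step : list (sentence P R) -> sentence P R -> Prop)
    (G : theory P R) : sentence P R -> Prop :=
| derivable_leaf : forall psi, G psi -> derivable step G psi
| derivable_node : forall l psi, step l psi ->
    (forall chi, In chi l -> derivable step G chi) -> derivable step G psi.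

Definition entailment_step (P R : Type) (k : nat)
    (l : list (sentence P R)) (psi : sentence P R) : Prop :=
  length l <= k /\ entails (fun chi => In chi l) psi.

Definition degree_entails (P R : Type) (k : nat) (G : theory P R)
    (phi : sentence P R) : Prop :=
  derivable (@entailment_step P R k) G phi.

(* The noun, verb, term and sentence variables are four disjoint sorts, each
   indexed by nat. *)
Inductive term_template : Type :=
| TNounVar : nat -> term_template
| TTermVar : nat -> term_template
| TVerbAll : nat -> term_template -> term_template.

Inductive sentence_template : Type :=
| TSentenceVar : nat -> sentence_template
| TAll : term_template -> term_template -> sentence_template
| TSome : term_template -> term_template -> sentence_template.

Record rule : Type := Rule {
  premises : list sentence_template;
  conclusion : sentence_template
}.

Definition proof_system : Type := list rule.

(* Substitutions are partial, so that a rule in which, say, no verb variable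
   occurs still has instances when the set of verbs is empty. *)
Record substitution (P R : Type) : Type := Substitution {
  noun_sub : nat -> option P;
  verb_sub : nat -> option R;
  term_sub : nat -> option (term P R);
  sentence_sub : nat -> option (sentence P R)
}.

Definition option_map2 (A B C : Type) (f : A -> B -> C)
    (a : option A) (b : option B) : option C :=
  match a, b with
  | Some a, Some b => Some (f a b)
  | _, _ => None
  end.

Fixpoint subst_term (P R : Type) (s : substitution P R) (t : term_template)
    : option (term P R) :=
  match t with
  | TNounVar i => option_map (@Noun P R) (noun_sub s i)
  | TTermVar i => term_sub s i
  | TVerbAll i u => option_map2 (@VerbAll P R) (verb_sub s i) (subst_term s u)
  end.

Definition subst_sentence (P R : Type) (s : substitution P R)
    (t : sentence_template) : option (sentence P R) :=
  match t with
  | TSentenceVar i => sentence_sub s i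
  | TAll u v => option_map2 (@All P R) (subst_term s u) (subst_term s v)
  | TSome u v => option_map2 (@Some_ P R) (subst_term s u) (subst_term s v)
  end.

(* [l] and [psi] are the premises and conclusion of a substitution instance of
   [rho]; the equations force [s] to be defined on every variable of [rho]. *)
Definition rule_instance (P R : Type) (rho : rule)
    (l : list (sentence P R)) (psi : sentence P R) : Prop :=
  exists s : substitution P R,
    map (subst_sentence s) (premises rho) = map Some l /\
    subst_sentence s (conclusion rho) = Some psi.

Definition proves (P R : Type) (S : proof_system) (G : theory P R)
    (phi : sentence P R) : Prop :=
  derivable (fun l psi => exists rho, In rho S /\ rule_instance rho l psi) G phi.

Definition sound (S : proof_system) : Prop :=
  forall (P R : Type) (G : theory P R) (phi : sentence P R),
    proves S G phi -> entails G phi.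

Definition complete (S : proof_system) : Prop :=
  forall (P R : Type) (G : theory P R) (phi : sentence P R),
    entails G phi -> proves S G phi.

(* Main.v *)
Require Import Defs.
From Stdlib Require Import List Lia Arith Classical.

(** Fix [n].  With two nouns [b], [y] and verbs [s], [r_0], [r_1], and so on,
    put [X = (r_0 all (s all (r_1 all (s all ... (r_n all (s all y))))))] and let
    the theory consist of [some X X] and of [all (r_k all b) y] for [k <= n].
    It entails [some y y]: if [y] is empty then so is every [(r_k all b)], and
    for an empty term [x] the term [(s all x)] is the whole domain [D], while
    [(r_k all D)] is contained in [(r_k all b)]; hence the emptiness of [y]
    propagates outwards through [X], which contradicts [some X X].

    This argument by cases on emptiness cannot be cut into steps with few
    premises, because what it shows after using only some of the links is not
    expressible by a sentence.  Precisely, let [T] consist of [some X X] and of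
    the sentences [all a c] that follow from a single link
    [all (r_k all b) y] with [k <= n] by reflexivity and antitonicity.  The set
    [T] contains the theory but not [some y y], and it is closed under
    entailment from at most [n] premises ([inT_entailment_step]):

    - at most [n] members of [T] use at most [n] links, so some link [i <= n]
      is unused, and it suffices to find models of the theory without link [i]
      ([exists_unused_link]);
    - if [all a c] is not in [T], it fails in the canonical model, whose points
      are the terms, with [t] lying in [u] when [all t u] is in [T];
    - if [a] is not [X], some model of the theory without link [i] makes [a]
      empty ([exists_empty_term]), so that [some a c] and [some c a] fail.  For
      most [a] this is the canonical model deprived of the points lying in
      [a].  That deletion can falsify a link only when [a] is [b], and can make
      [X] empty only when [a] lies above a proper subterm of [X]; in these two
      cases a one-point model does the job.

    In a sound proof system every rule instance is an entailment from at most
    [n] premises, where [n] bounds the number of premises of the finitely many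
    rules; so for this [n] the system does not derive [some y y] from the above
    theory. *)

Set Implicit Arguments.

Inductive noun : Type := B | Y.

(** [Link k] is the verb [r_k] and [Sep] is the verb [s] of the introduction. *)
Inductive verb : Type := Link (k : nat) | Sep.

Notation tm := (term noun verb).

Definition b : tm := Noun verb B.
Definition y : tm := Noun verb Y.

(** [nest k m] is [(r_k all (s all ... (r_(k+m-1) all (s all y))))]. *)
Fixpoint nest (k m : nat) : tm :=
  match m with
  | 0 => y
  | S m => VerbAll (Link k) (VerbAll Sep (nest (S k) m))
  end.

(** [all (r_k all b) y] *)
Definition link (k : nat) : sentence noun verb := All (VerbAll (Link k) b) y.

(** The term [X] of the introduction. *)
Definition nested (n : nat) : tm := nest 0 (S n).

(** The theory of the introduction: [some X X] and [S n] links. *)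
Definition chain_theory (n : nat) : theory noun verb := fun psi =>
  psi = Some_ (nested n) (nested n) \/ exists k, k <= n /\ psi = link k.

Lemma chain_theory_entails n : entails (chain_theory n) (Some_ y y).
Proof.
  intros M HM. apply NNPP. intros Hy.
  assert (Hempty : forall m k, k + m <= S n ->
            forall e : M, ~ term_int M (nest k m) e).
  { induction m as [|m IH]; intros k Hk e He.
    - apply Hy. now exists e.
    - apply Hy. exists e.
      assert (He' : term_int M y e); [|now split].
      assert (Hlink : chain_theory n (link k)).
      { right. exists k. split; [lia | reflexivity]. }
      apply (HM _ Hlink e). intros e' _. apply He.
      intros e'' He''. exfalso. revert He''. apply IH. lia. }
  destruct (HM _ (or_introl eq_refl)) as [e [He _]].
  exact (Hempty (S n) 0 (Nat.le_refl _) e He).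
Qed.

(** * Consequences of a single link *)

(** [le k t u]: [all t u] follows from [all (r_k all b) y] by reflexivity and by
    antitonicity of [(v all _)].  No transitivity is needed. *)
Inductive le (k : nat) : tm -> tm -> Prop :=
| le_refl t : le k t t
| le_link : le k (VerbAll (Link k) b) y
| le_anti v t u : le k t u -> le k (VerbAll v u) (VerbAll v t).

Lemma le_sound k (M : model noun verb) t u :
  satisfies M (link k) -> le k t u -> satisfies M (All t u).
Proof.
  intros HM H. induction H as [t| |v t u _ IH]; cbn in *; auto.
Qed.

Lemma le_noun_l k p u : le k (Noun verb p) u -> u = Noun verb p.
Proof. intros H. now inversion H. Qed.

(** Two links never compose: their right-hand side [y] contains none of their
    left-hand sides, and a term has a single innermost noun. *)
Lemma le_trans k l t u w : le k t u -> le l u w -> le k t w \/ le l t w.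
Proof.
  revert k l t w. induction u as [p|v u IH]; intros k l t w Htu Huw.
  - apply le_noun_l in Huw. subst w. now left.
  - inversion Htu as [ | |v' u' t' Ht]; subst; [now right|].
    inversion Huw as [ | |v' w' u' Hw]; subst.
    + now left.
    + apply le_noun_l in Ht. subst t'. right. constructor.
    + destruct (IH _ _ _ _ Hw Ht); [right | left]; now constructor.
Qed.

Fixpoint leaf (t : tm) : noun :=
  match t with Noun _ p => p | VerbAll _ u => leaf u end.

Lemma le_leaf k t u : le k t u -> leaf t = leaf u -> t = u.
Proof.
  intros H. induction H as [t| |v t u _ IH]; cbn; intros Hl.
  - reflexivity.
  - discriminate.
  - now rewrite IH.
Qed.

(** Replacing [y] by [(r_k all b)] at its positive occurrence in [nest j m]
    makes the term smaller, so [nest j m] is maximal. *)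
Lemma le_nest k j m u : le k (nest j m) u -> u = nest j m.
Proof.
  revert j u. induction m as [|m IH]; intros j u H.
  - now apply le_noun_l in H.
  - inversion H as [ | |v' u' t' H1]; subst; [reflexivity|].
    inversion H1 as [ | |v'' u'' t'' H2]; subst; [reflexivity|].
    now rewrite (IH _ _ H2).
Qed.

(** The preorder [all a c] in [T] of the introduction. *)
Definition le_upto (n : nat) (t u : tm) : Prop := exists k, k <= n /\ le k t u.

Lemma le_upto_refl n t : le_upto n t t.
Proof. exists 0. split; [lia | constructor]. Qed.

Lemma le_upto_trans n t u w : le_upto n t u -> le_upto n u w -> le_upto n t w.
Proof.
  intros [k [Hk H]] [l [Hl H']].
  destruct (le_trans H H'); [exists k | exists l]; auto.
Qed.

Lemma le_upto_anti n v t u :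
  le_upto n t u -> le_upto n (VerbAll v u) (VerbAll v t).
Proof. intros [k [Hk H]]. exists k. split; [assumption | now constructor]. Qed.

Lemma le_upto_link n k : k <= n -> le_upto n (VerbAll (Link k) b) y.
Proof. intros Hk. exists k. split; [assumption | constructor]. Qed.

(** * The canonical model and its restrictions *)

(** The points are the terms outside [e], and [t] is related by [v] to [u] when
    [t] lies below [(v all u)]. *)
Definition canonical (n : nat) (e : tm -> Prop) : model noun verb :=
  @Model noun verb {t : tm | ~ e t}
    (fun p t => le_upto n (proj1_sig t) (Noun verb p))
    (fun v t u => le_upto n (proj1_sig t) (VerbAll v (proj1_sig u))).

(** No proper subterm of [u] belongs to [e]. *)
Fixpoint clean (e : tm -> Prop) (u : tm) : Prop :=
  match u with
  | Noun _ _ => True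
  | VerbAll _ w => ~ e w /\ clean e w
  end.

(** The points of [u] are the terms below [u], for every clean [u].  Cleanness is
    needed because, when [w] is deleted, membership in [(v all w)] is no longer
    tested on the point [w] itself. *)
Lemma canonical_int n e u : clean e u ->
  forall t : canonical n e,
    term_int (canonical n e) u t <-> le_upto n (proj1_sig t) u.
Proof.
  induction u as [p|v u IH]; cbn; [reflexivity|].
  intros [Hu Hc] t. specialize (IH Hc). split.
  - intros H. apply (H (exist _ u Hu)). apply IH. apply le_upto_refl.
  - intros H u' Hu'. apply (le_upto_trans H). apply le_upto_anti. now apply IH.
Qed.

Lemma canonical_link n e k : k <= n -> ~ e b -> satisfies (canonical n e) (link k).
Proof.
  intros Hk Hb t Ht. apply (le_upto_trans (u := VerbAll (Link k) b)).
  - apply (@canonical_int n e (VerbAll (Link k) b)); [split; [exact Hb | exact I] |].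
    exact Ht.
  - now apply le_upto_link.
Qed.

Lemma canonical_nonempty n e u :
  clean e u -> ~ e u -> satisfies (canonical n e) (Some_ u u).
Proof.
  intros Hc Hu. exists (exist _ u Hu).
  split; apply canonical_int; auto; apply le_upto_refl.
Qed.

Lemma clean_none u : clean (fun _ => False) u.
Proof. induction u; cbn; auto. Qed.

(** A subterm of [a] has the same innermost noun as [a], so it lies below [a]
    only if it is [a] itself. *)
Lemma clean_below n a : clean (fun t => le_upto n t a) a.
Proof.
  assert (H : forall (size : tm -> nat),
             (forall v u, size (VerbAll v u) = S (size u)) ->
             forall u, leaf u = leaf a -> size u <= size a ->
             clean (fun t => le_upto n t a) u).
  { intros size Hs u. induction u as [p|v u IH]; cbn; [auto|].
    rewrite Hs. intros Hl Hle. split; [|apply IH; [assumption | lia]].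
    intros [k [_ Hk]]. apply le_leaf in Hk; [subst; lia | assumption]. }
  apply (H (fix size (t : tm) :=
              match t with Noun _ _ => 0 | VerbAll _ u => S (size u) end));
    auto.
Qed.

Lemma canonical_below_empty n a (t : canonical n (fun t => le_upto n t a)) :
  ~ term_int (canonical n (fun t => le_upto n t a)) a t.
Proof.
  intros Ht. apply canonical_int in Ht; [|apply clean_below].
  destruct t as [t Ht']. now apply Ht'.
Qed.

(** The proper subterms of [nest k m] are the [nest j l] and
    [(s all (nest j l))] with [j > k] and [j + l = k + m]. *)
Lemma nest_clean_or e m k :
  clean e (nest k m) \/
  exists j l, k < j /\ j + l = k + m /\
    (e (nest j l) \/ e (VerbAll Sep (nest j l))).
Proof.
  revert k. induction m as [|m IH]; intros k; cbn [nest clean].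
  - now left.
  - destruct (classic (e (nest (S k) m) \/ e (VerbAll Sep (nest (S k) m))))
      as [He|He].
    + right. exists (S k), m. repeat split; auto; lia.
    + destruct (IH (S k)) as [Hc|[j [l [Hj [Hl H]]]]].
      * left. tauto.
      * right. exists j, l. repeat split; auto; lia.
Qed.

(** * One-point models *)

(** The point belongs to [p] when [nv p], and is related to itself by [v] when
    [vv v]. *)
Definition point (nv : noun -> Prop) (vv : verb -> Prop) : model noun verb :=
  @Model noun verb unit (fun p _ => nv p) (fun v _ _ => vv v).

(** [M] satisfies [chain_theory n], except possibly the link of index [i]. *)
Definition models_without (n i : nat) (M : model noun verb) : Prop :=
  satisfies M (Some_ (nested n) (nested n)) /\
  forall k, k <= n -> k <> i -> satisfies M (link k).

(** [y] is empty, and [r_i] is the only nonempty relation. *)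
Lemma exists_empty_y n i : i <= n ->
  exists M, models_without n i M /\ forall e : M, ~ term_int M y e.
Proof.
  intros Hi.
  set (M := point (fun p => p = B) (fun v => v = Link i)).
  exists M. split; [split|].
  - assert (H : forall m k, k <= i < k + m -> term_int M (nest k m) tt).
    { induction m as [|m IH]; intros k Hk; [lia|].
      destruct (Nat.eq_dec k i) as [->|Hki]; cbn.
      - intros [] _. reflexivity.
      - intros [] Hs. enough (Sep = Link i) by discriminate.
        apply (Hs tt). apply IH. lia. }
    exists tt. split; apply H; lia.
  - intros k _ Hki [] H. cbn in H. destruct Hki.
    now injection (H tt eq_refl).
  - intros [] H. discriminate H.
Qed.

(** [s] and [r_0] are full, all the other relations are empty. *)
Lemma exists_empty_nest n i j l :
  exists M, models_without n i M /\ forall e : M, ~ term_int M (nest (S j) (S l)) e.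
Proof.
  set (M := point (fun _ => True) (fun v => v = Sep \/ v = Link 0)).
  exists M. split; [split|].
  - exists tt. cbn. auto.
  - intros k _ _ m _. exact I.
  - intros [] H. cbn in H.
    destruct (H tt) as [H'|H']; try discriminate. auto.
Qed.

(** [s] is empty, everything else is full; in particular the two sides of each
    link agree. *)
Lemma exists_empty_sep n i k j l c : le k c (nest j l) ->
  exists M, models_without n i M /\ forall e : M, ~ term_int M (VerbAll Sep c) e.
Proof.
  set (M := point (fun _ => True) (fun v => v <> Sep)).
  intros Hc. exists M.
  assert (Hnest : forall m k, term_int M (nest k m) tt).
  { intros [|m] k'; cbn; [trivial | discriminate]. }
  split; [split|].
  - exists tt. split; apply Hnest.
  - intros k' _ _ m _. exact I.
  - assert (Heq : forall t u, le k t u -> term_int M t tt <-> term_int M u tt).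
    { intros t u H. induction H as [t| |v t u _ IH]; [reflexivity| |].
      - cbn. split; [trivial | discriminate].
      - cbn. split; intros H [] Ht; apply (H tt); now apply IH. }
    assert (Hct : term_int M c tt) by (apply (Heq _ _ Hc); apply Hnest).
    intros [] H. exact (H tt Hct eq_refl).
Qed.

(** [b] is empty, everything else is full. *)
Lemma exists_empty_b n i :
  exists M, models_without n i M /\ forall e : M, ~ term_int M b e.
Proof.
  exists (point (fun p => p <> B) (fun _ => True)). split; [split|].
  - exists tt. cbn. auto.
  - intros k _ _ m _. cbn. discriminate.
  - intros e H. now apply H.
Qed.

Lemma exists_empty_term n i a : i <= n -> a <> nested n ->
  exists M, models_without n i M /\ forall e : M, ~ term_int M a e.
Proof.
  intros Hi Ha.
  destruct (classic (a = b)) as [->|Hb]; [apply exists_empty_b|].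
  set (e := fun t => le_upto n t a).
  destruct (nest_clean_or e (S n) 0) as [Hc|[j [l [Hj [Hl [[k [_ H]]|[k [_ H]]]]]]]].
  - exists (canonical n e). split; [split|].
    + apply canonical_nonempty; [exact Hc|].
      intros [k [_ H]]. apply Ha. exact (le_nest 0 (S n) H).
    + intros k Hk _. apply canonical_link; [exact Hk|].
      intros [k' [_ H]]. apply Hb. exact (le_noun_l H).
    + apply canonical_below_empty.
  - apply le_nest in H. subst a. destruct j as [|j]; [lia|].
    destruct l as [|l]; [now apply exists_empty_y | apply exists_empty_nest].
  - inversion H as [ | |v c t Hle]; subst.
    + eapply exists_empty_sep, le_refl with (k := 0).
    + now apply exists_empty_sep with (1 := Hle).
Qed.

(** * A set of sentences closed under entailment from few premises *)

(** The set [T] of the introduction. *)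
Definition inT (n : nat) (psi : sentence noun verb) : Prop :=
  match psi with
  | All a c => le_upto n a c
  | Some_ a c => a = nested n /\ c = nested n
  end.

Lemma inT_one_link n psi : inT n psi ->
  exists k, forall M, satisfies M (Some_ (nested n) (nested n)) ->
    (k <= n -> satisfies M (link k)) -> satisfies M psi.
Proof.
  destruct psi as [a c|a c]; cbn [inT].
  - intros [k [Hk H]]. exists k. intros M _ HM. now apply (@le_sound k M a c); auto.
  - intros [-> ->]. exists 0. auto.
Qed.

(** Each of the at most [n] premises needs one link, and there are [S n] links. *)
Lemma exists_unused_link n l :
  length l <= n -> (forall psi, In psi l -> inT n psi) ->
  exists i, i <= n /\
    forall M, models_without n i M -> forall psi, In psi l -> satisfies M psi.
Proof.
  intros Hlen Hl.
  assert (Hks : exists ks, length ks = length l /\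
            forall M, satisfies M (Some_ (nested n) (nested n)) ->
              (forall k, k <= n -> In k ks -> satisfies M (link k)) ->
              forall psi, In psi l -> satisfies M psi).
  { clear Hlen. induction l as [|psi l IH].
    - exists nil. cbn. split; [reflexivity | tauto].
    - destruct IH as [ks [Hlen H]]; [intros; apply Hl; now right|].
      destruct (inT_one_link n psi) as [k Hk]; [apply Hl; now left|].
      exists (k :: ks). cbn [length In]. split; [now rewrite Hlen|].
      intros M HX HM chi [<-|Hchi]; [apply Hk | apply H]; auto. }
  destruct Hks as [ks [Hks H]].
  assert (Hi : exists i, i <= n /\ ~ In i ks).
  { apply NNPP. intros Hno.
    assert (Hincl : incl (seq 0 (S n)) ks).
    { intros i Hi. apply in_seq in Hi. apply NNPP. intros Hi'.
      apply Hno. exists i. split; [lia | assumption]. }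
    apply NoDup_incl_length in Hincl; [|apply seq_NoDup].
    rewrite length_seq in Hincl. lia. }
  destruct Hi as [i [Hi Hnot]]. exists i. split; [assumption|].
  intros M [HX HM]. apply H; [assumption|].
  intros k Hk Hin. apply HM; [assumption | now intros ->].
Qed.

Lemma inT_entailment_step n l psi :
  entailment_step n l psi -> (forall chi, In chi l -> inT n chi) -> inT n psi.
Proof.
  intros [Hlen Hent] Hl.
  destruct (exists_unused_link _ Hlen Hl) as [i [Hi HM]].
  destruct psi as [a c|a c]; cbn [inT].
  - set (M := canonical n (fun _ => False)).
    assert (Hsat : satisfies M (All a c)).
    { apply Hent. apply HM. split.
      - apply canonical_nonempty; [apply clean_none | tauto].
      - intros k Hk _. apply canonical_link; tauto. }
    assert (Ha := Hsat (exist _ a (fun H => H))).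
    unfold M in Ha. rewrite !canonical_int in Ha by apply clean_none.
    apply Ha. apply le_upto_refl.
  - split; apply NNPP; intros Hne;
      destruct (exists_empty_term Hi Hne) as [M [HM' Hempty]];
      destruct (Hent M (HM M HM')) as [e [Hea Hec]];
      now apply (Hempty e).
Qed.

Lemma chain_theory_not_degree_entails n :
  ~ degree_entails n (chain_theory n) (Some_ y y).
Proof.
  intros H.
  assert (HT : inT n (Some_ y y)).
  { induction H as [psi HG|l psi Hstep _ IH].
    - destruct HG as [->|[k [Hk ->]]].
      + now split.
      + now apply le_upto_link.
    - now apply (inT_entailment_step Hstep). }
  destruct HT as [HT _]. discriminate HT.
Qed.

(** * Proof systems *)

Lemma derivable_mono (P R : Type)
    (step step' : list (sentence P R) -> sentence P R -> Prop) G phi :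
  (forall l psi, step l psi -> step' l psi) ->
  derivable step G phi -> derivable step' G phi.
Proof.
  intros Hstep H. induction H as [psi HG|l psi Hs _ IH].
  - now constructor.
  - apply derivable_node with l; auto.
Qed.

Lemma sound_rule_instance (S : proof_system) (P R : Type) rho l
    (psi : sentence P R) :
  sound S -> In rho S -> rule_instance rho l psi ->
  entailment_step (length (premises rho)) l psi.
Proof.
  intros HS Hrho Hinst. split.
  - destruct Hinst as [s [Hl _]].
    apply (f_equal (@length _)) in Hl. rewrite !length_map in Hl. lia.
  - apply HS. apply derivable_node with l; [now exists rho|].
    intros chi Hchi. now constructor.
Qed.

Lemma bounded_premises (S : proof_system) :
  exists n, forall rho, In rho S -> length (premises rho) <= n.
Proof.
  induction S as [|rho S [n Hn]].
  - exists 0. intros rho [].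
  - exists (length (premises rho) + n). intros rho' [<-|H]; [lia|].
    specialize (Hn _ H). lia.
Qed.

Lemma sound_proves_degree_entails (S : proof_system) : sound S ->
  exists n, forall (P R : Type) (G : theory P R) phi,
    proves S G phi -> degree_entails n G phi.
Proof.
  intros HS. destruct (bounded_premises S) as [n Hn]. exists n.
  intros P R G phi. apply derivable_mono. intros l psi [rho [Hrho Hinst]].
  destruct (sound_rule_instance HS Hrho Hinst) as [Hlen Hent].
  split; [|assumption]. specialize (Hn _ Hrho). lia.
Qed.

Unset Implicit Arguments.

Theorem theorem2p11 :
  (forall n : nat,
     exists (P R : Type) (G : theory P R) (phi : sentence P R),
       entails G phi /\ ~ degree_entails n G phi) /\
  ~ (exists S : proof_system, sound S /\ complete S).
Proof.
  split.
  - intros n. exists noun, verb, (chain_theory n), (Some_ y y).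
    split; [apply chain_theory_entails | apply chain_theory_not_degree_entails].
  - intros [S [Hsound Hcomplete]].
    destruct (sound_proves_degree_entails Hsound) as [n Hn].
    apply (@chain_theory_not_degree_entails n). apply Hn, Hcomplete.
    apply chain_theory_entails.
Qed.
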